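(* Let $A,M,S$ be positive integers with $M\geq S^2$, and let $\alpha,\beta>0$. Let $\Omega\subset\mathbb{T}$ satisfy the clumps model with a minimum separation with parameters $(A,M,S,\beta,\alpha)$, with clumps $\Lambda_1,\dots,\Lambda_A$ of cardinalities $\lambda_1,\dots,\lambda_A$. If $A>1$, assume moreover that $$\beta\geq\max_{1\le a\le A}\frac{20\,S^{1/2}\lambda_a^{5/2}}{\alpha^{1/2}}.$$ For $1\le a\le A$ define $$B_a:=\frac{20\sqrt2}{19}\Big(1-\frac{\pi^2}{3\lambda_a^2}\Big)^{-(\lambda_a-1)/2}\Big(\frac{M}{\lambda_a}\Big)^{\lambda_a-1}\Big\lfloor\frac{M}{\lambda_a}\Big\rfloor^{-(\lambda_a-1)},$$ $$C_a:=C_a(\lambda_a,M):=B_a\lambda_a\Big(\frac{\lambda_a}{\pi}\Big)^{\lambda_a-1}\Big(\sum_{j=1}^{\lambda_a}\ \prod_{k=1,\,k\neq j}^{\lambda_a}\frac{1}{(j-k)^2}\Big)^{1/2}.$$ Then $$\sigma_{\min}(\Phi(\Omega,M))\geq\sqrt M\,\Big(\sum_{a=1}^A\big(C_a\,\alpha^{-\lambda_a+1}\big)^2\Big)^{-1/2}.$$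
   Context: $\mathbb{T}=[0,1)$ is the periodic unit interval ($\mathbb{R}/\mathbb{Z}$), with $|\omega|_{\mathbb{T}}:=\min_{n\in\mathbb{Z}}|\omega-n|$. For $\Omega=\{\omega_j\}_{j=1}^S\subset\mathbb{T}$ (distinct points), $\Phi(\Omega,M)$ is the $(M+1)\times S$ Vandermonde matrix with entries $\Phi_{m,j}=e^{-2\pi i m\omega_j}$, $0\le m\le M$, $1\le j\le S$. $\sigma_{\min}(\Phi)=\min_{\|v\|_2=1}\|\Phi v\|_2$. Clumps model with a minimum separation with parameters $(A,M,S,\beta,\alpha)$: (1) $\Omega$ has cardinality $S$ and is a disjoint union $\Omega=\bigcup_{a=1}^A\Lambda_a$ of nonempty finite sets (clumps), each $\Lambda_a$ being contained in an open interval (arc) of length $1/M$; (2) if $A>1$, then $|\omega-\omega'|_{\mathbb{T}}\ge\beta/M$ whenever $\omega,\omega'$ belong to different clumps; (3) the minimum separation $\Delta=\min_{j\neq k}|\omega_j-\omega_k|_{\mathbb{T}}$ of $\Omega$ satisfies $\Delta\ge\alpha/M$, and $\max_{1\le a\le A}(\lambda_a-1)<1/\alpha$, where $\lambda_a:=|\Lambda_a|$. When $\lambda_a=1$ all powers with exponent $0$ and empty products equal $1$. *)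

(* Defs.v *)
From mathcomp Require Import all_boot all_order all_algebra.
From mathcomp Require Import complex.
From mathcomp Require Import all_classical all_reals all_analysis.

Set Implicit Arguments.
Unset Strict Implicit.
Unset Printing Implicit Defensive.

Import Order.TTheory GRing.Theory Num.Theory.
Import ComplexField.Normc.

Local Open Scope classical_set_scope.
Local Open Scope complex_scope.
Local Open Scope ring_scope.

Section Vandermonde.
Variable R : realType.

Definition expi (t : R) : R[i] := cos t +i* sin t.

Definition l2norm (n : nat) (v : 'cV[R[i]]_n) : R :=
  Num.sqrt (\sum_(i < n) normc (v i ord0) ^+ 2).

(* The infimum is attained for n > 0, the unit sphere being compact. *)
Definition sigma_min (m n : nat) (P : 'M[R[i]]_(m, n)) : R :=
  inf [set l2norm (P *m v) | v in [set v : 'cV[R[i]]_n | l2norm v = 1]].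

Definition Phi (S : nat) (omega : 'I_S -> R) (M : nat) : 'M[R[i]]_(M.+1, S) :=
  \matrix_(m < M.+1, j < S) expi (- (2 * pi * m%:R * omega j)).

(* The infimum over the integers is attained. *)
Definition tnorm (x : R) : R := inf [set `|x - n%:~R| | n in [set: int]].

(* The open arc of R/Z of length l starting at c, as a 1-periodic subset
   of R. *)
Definition open_arc (c l : R) : set R :=
  [set x | exists n : int, c < x + n%:~R < c + l].

(* The value is +oo if S <= 1, when there are no two distinct points. *)
Definition min_separation (S : nat) (omega : 'I_S -> R) : \bar R :=
  \big[Order.min/+oo%E]_(p : 'I_S * 'I_S | p.1 != p.2)
    (tnorm (omega p.1 - omega p.2))%:E.

(* Omega is enumerated by omega, and the clump Lambda_a is given by the set
   Lambda a of the indices of its points. *)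
Record clumps_model_with_min_separation (A M S : nat) (beta alpha : R)
    (omega : 'I_S -> R) (Lambda : 'I_A -> {set 'I_S}) : Prop :=
  ClumpsModel {
    clumps_in_torus : forall j, 0 <= omega j < 1;
    clumps_distinct : injective omega;
    clumps_cover : (\bigcup_(a < A) Lambda a)%SET = [set: 'I_S]%SET;
    clumps_disjoint : forall a b, a != b -> (Lambda a :&: Lambda b)%SET = finset.set0;
    clumps_nonempty : forall a, Lambda a != finset.set0;
    clumps_arc : forall a, exists c : R,
      forall j, j \in Lambda a -> open_arc c (M%:R^-1) (omega j);
    clumps_separated : (1 < A)%N -> forall a b, a != b ->
      forall j k, j \in Lambda a -> k \in Lambda b ->
        beta / M%:R <= tnorm (omega j - omega k);
    clumps_min_separation : ((alpha / M%:R)%:E <= min_separation omega)%E;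
    clumps_card : (\max_(a < A) (#|Lambda a| - 1))%N%:R < alpha^-1 }.

(* For l = 1 the base of `^ is negative, but the exponent is 0 and the power
   is 1. *)
Definition Bconst (l M : nat) : R :=
  20 * Num.sqrt 2 / 19
  * (1 - pi ^+ 2 / (3 * l%:R ^+ 2)) `^ (- ((l - 1)%:R / 2))
  * (M%:R / l%:R) ^+ (l - 1)
  * (Num.floor (M%:R / l%:R : R))%:~R ^- (l - 1).

Definition Cconst (l M : nat) : R :=
  Bconst l M * l%:R * (l%:R / pi) ^+ (l - 1)
  * Num.sqrt (\sum_(1 <= j < l.+1) \prod_(1 <= k < l.+1 | k != j)
                ((j%:R - k%:R) ^+ 2)^-1).

End Vandermonde.

(* Main.v *)
(** Write z_j = exp(-2 pi i omega_j). If the polynomials H_j have degree at most M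
    and H_j(z_k) is close to 1 for j = k and to 0 otherwise, then, for a unit
    vector v, the coefficient vector p of sum_j conj(v_j) H_j pairs with Phi v to
    nearly 1, and Cauchy-Schwarz gives a lower bound on the norm of Phi v in
    terms of that of p. For z_j in a clump of l points, H_j is the product of the
    Lagrange polynomial of the clump in the variable X^Q, Q = floor(M/l), with the 2l-th
    power of a normalized Dirichlet kernel centred at z_j. The former makes H_j
    exact on the clump, with sup norm controlled by the separation alpha/M; the
    latter brings the L2 norm down to O(l/sqrt M), by Parseval, and makes H_j
    tiny on the other clumps, by the separation beta/M.

    This error bound needs alpha <= 1. If alpha > 1 then all clumps are
    singletons, which are separated by max(alpha, beta)/M; then the Gram form of
    Phi, weighted by the coefficients of the fourth power of the Dirichlet
    kernel, is diagonally dominant. *)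
Require Import Defs.
From mathcomp Require Import all_boot all_order all_algebra.
From mathcomp Require Import complex.
From mathcomp Require Import all_classical all_reals all_analysis.
From mathcomp Require Import ring lra zify.
Import Order.TTheory GRing.Theory Num.Theory.
Import ComplexField.Normc.
Import numFieldNormedType.Exports.
Set Implicit Arguments.
Unset Strict Implicit.
Unset Printing Implicit Defensive.
Local Open Scope ring_scope.

(** * Taylor bounds for sine and cosine *)

(** Bootstraps the Taylor bounds: the derivative of each remainder is the remainder treated just
    before. *)
Lemma is_derive_ge0_ge0 (R : realType) (f df : R -> R) (x : R) :
  (forall y : R, is_derive y (1 : R) f (df y)) -> (forall y, 0 < y -> 0 <= df y) ->
  0 <= f 0 -> 0 <= x -> 0 <= f x.
Proof.
move=> dE df0 f0; rewrite le_eqVlt => /predU1P[<- //|x0].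
apply: (le_trans f0).
have dfx y : derivable f y 1 by case: (dE y).
apply: (@ger0_derive1_ndecr R f 0 x _ _ _ 0 x) => //; last exact: ltW.
- move=> y; rewrite in_itv /= => /andP[y0 _].
  by rewrite derive1E; case: (dE y) => _ ->; exact: df0.
- apply: continuous_subspaceT => y; apply: differentiable_continuous.
  exact/derivable1_diffP.
Qed.

Lemma sin_le_id (R : realType) (x : R) : 0 <= x -> sin x <= x.
Proof.
move=> x0; rewrite -subr_ge0.
apply: (@is_derive_ge0_ge0 _ (fun y => y - sin y) (fun y => 1 - cos y)
  x _ _ _ x0).
- by move=> y _; rewrite subr_ge0 cos_le1.
- by rewrite sin0 subrr.
Qed.

Lemma cos_ge_quad (R : realType) (x : R) : 0 <= x -> 1 - x ^+ 2 / 2 <= cos x.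
Proof.
move=> x0; rewrite -subr_ge0.
apply: (@is_derive_ge0_ge0 _ (fun y => cos y - (1 - y ^+ 2 / 2))
  (fun y => y - sin y) x _ _ _ x0).
- move=> y; apply: trigger_derive.
  rewrite /GRing.scale /=; by field.
- by move=> y y0; rewrite subr_ge0; apply: sin_le_id; exact: ltW.
- rewrite cos0; lra.
Qed.

Lemma sin_ge_cubic (R : realType) (x : R) : 0 <= x -> x - x ^+ 3 / 6 <= sin x.
Proof.
move=> x0; rewrite -subr_ge0.
apply: (@is_derive_ge0_ge0 _ (fun y => sin y - (y - y ^+ 3 / 6))
  (fun y => cos y - (1 - y ^+ 2 / 2)) x _ _ _ x0).
- move=> y; apply: trigger_derive.
  rewrite /GRing.scale /=; by field.
- by move=> y y0; rewrite subr_ge0; apply: cos_ge_quad; exact: ltW.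
- rewrite sin0; lra.
Qed.

Lemma cos_le_quartic (R : realType) (x : R) :
  0 <= x -> cos x <= 1 - x ^+ 2 / 2 + x ^+ 4 / 24.
Proof.
move=> x0; rewrite -subr_ge0.
apply: (@is_derive_ge0_ge0 _ (fun y => 1 - y ^+ 2 / 2 + y ^+ 4 / 24 - cos y)
  (fun y => sin y - (y - y ^+ 3 / 6)) x _ _ _ x0).
- move=> y; apply: trigger_derive.
  rewrite /GRing.scale /=; by field.
- by move=> y y0; rewrite subr_ge0; apply: sin_ge_cubic; exact: ltW.
- rewrite cos0; lra.
Qed.

(** The quadratic bound on cosine at its zero pi / 2 forces pi^2 >= 8. *)
Lemma pi_gt_28 (R : realType) : 28 / 10 < pi :> R.
Proof.
rewrite ltNge; apply/negP => h.
have := @cos_ge_quad R (pi / 2); rewrite cos_pihalf divr_ge0 ?pi_ge0// => /(_ isT).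
have := pi_gt0 R; nra.
Qed.

(** The quartic bound is negative at 1.6, while cosine is nonnegative up to pi / 2. *)
Lemma pi_lt_32 (R : realType) : pi < 32 / 10 :> R.
Proof.
rewrite ltNge; apply/negP => h.
have h1 : cos (16 / 10) < 0 :> R.
  have := @cos_le_quartic R (16 / 10); rewrite !exprS expr0; lra.
have : 0 <= cos (16 / 10) :> R by apply: cos_ge0_pihalf; apply/andP; split; lra.
by rewrite leNgt h1.
Qed.

(** Holds since 1 - x^2 / 3 <= (1 - x^2 / 6)^2. The condition is on c^2 because c will be
    [Num.sqrt (sine_loss l)]. *)
Lemma sin_ge_mul (R : realType) (x c : R) : 0 <= c -> 0 <= x -> x ^+ 2 <= 6 ->
  c ^+ 2 <= 1 - x ^+ 2 / 3 -> c * x <= sin x.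
Proof.
move=> c0 x0 x6 hc; apply: le_trans (sin_ge_cubic x0).
have h : c <= 1 - x ^+ 2 / 6 by rewrite -(@ler_pXn2r _ 2) ?nnegrE//; nra.
rewrite exprS; nra.
Qed.

(** * Complex exponentials and discrete Parseval *)

Section ComplexNorm.
Local Open Scope complex_scope.
Variable R : realType.
Implicit Types (x y z : R[i]) (a b t : R).

Lemma normc_ge0 x : 0 <= normc x.
Proof. by case: x => a b; exact: sqrtr_ge0. Qed.

Lemma ler_normcD x y : normc (x + y) <= normc x + normc y.
Proof. exact: le_normcD. Qed.

Lemma ler_normc_sum (I : Type) (r : seq I) (P : pred I) (F : I -> R[i]) :
  normc (\sum_(i <- r | P i) F i) <= \sum_(i <- r | P i) normc (F i).
Proof.
elim/big_rec2: _ => [|i u v _ h]; first by rewrite normc0.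
by apply: le_trans (ler_normcD _ _) _; rewrite lerD2l.
Qed.

Lemma normc_prod (I : Type) (r : seq I) (P : pred I) (F : I -> R[i]) :
  normc (\prod_(i <- r | P i) F i) = \prod_(i <- r | P i) normc (F i).
Proof. exact: (big_morph _ (@normcM R) (@normc1 R)). Qed.

Lemma normcX x n : normc (x ^+ n) = normc x ^+ n.
Proof. by elim: n => [|n IH]; rewrite ?expr0 ?normc1// !exprS normcM IH. Qed.

Lemma normc_conj x : normc x^*%C = normc x.
Proof. by case: x => a b /=; rewrite sqrrN. Qed.

Lemma normc_real a : normc a%:C = `|a|.
Proof. by rewrite /= expr0n addr0 sqrtr_sqr. Qed.

Lemma normcB_sym x y : normc (x - y) = normc (y - x).
Proof. by rewrite -opprB normcN. Qed.

Lemma sqr_normc_conj x : (normc x ^+ 2)%:C = x * x^*%C.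
Proof. by rewrite -sqr_normc rmorphXn. Qed.

Lemma expiD a b : expi (a + b) = expi a * expi b.
Proof. by rewrite /expi cosD sinD; simpc; congr (_ +i* _); ring. Qed.

Lemma expi0 : expi 0 = 1 :> R[i].
Proof. by rewrite /expi sin0 cos0. Qed.

Lemma expiX a n : expi a ^+ n = expi (n%:R * a).
Proof.
elim: n => [|n IH]; first by rewrite mul0r expi0 expr0.
by rewrite exprS IH -expiD -natr1 mulrDl mul1r addrC.
Qed.

Lemma expiN a : expi (- a) = (expi a)^*%C.
Proof. by rewrite /expi cosN sinN. Qed.

Lemma normc_expi a : normc (expi a) = 1.
Proof. by rewrite /= cos2Dsin2 sqrtr1. Qed.

Lemma expi_conjM a : expi a * (expi a)^*%C = 1.
Proof. by rewrite -expiN -expiD subrr expi0. Qed.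

Lemma expi_2pi : expi (2 * pi) = 1 :> R[i].
Proof. by rewrite /expi mulr_natl cos2pi sin2pi. Qed.

Lemma normc_expiB a b : normc (expi a - expi b) = 2 * `|sin ((a - b) / 2)|.
Proof.
have [u [v [-> ->]]] : exists u v, a = u + v /\ b = u - v.
  by exists ((a + b) / 2), ((a - b) / 2); split; field.
have -> : (u + v - (u - v)) / 2 = v by field.
have -> : expi (u + v) - expi (u - v) = expi u * (0 +i* (2 * sin v)).
  rewrite !expiD -mulrBr; congr (_ * _); rewrite /expi cosN sinN; simpc.
  by congr (_ +i* _); ring.
by rewrite normcM normc_expi mul1r /= expr0n add0r sqrtr_sqr normrM ger0_norm.
Qed.

End ComplexNorm.

(** The quadratic A t^2 - 2 D t + B is a sum of squares, hence nonnegative at its minimizer t = D /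
    A; if A = 0 then f vanishes. *)
Lemma sum_CauchySchwarz (R : realType) (I : finType) (P : pred I) (f g : I -> R) :
  (\sum_(i | P i) f i * g i) ^+ 2
    <= (\sum_(i | P i) f i ^+ 2) * (\sum_(i | P i) g i ^+ 2).
Proof.
set A := \sum_(i | P i) f i ^+ 2; set B := \sum_(i | P i) g i ^+ 2.
set D := \sum_(i | P i) _.
have A0 : 0 <= A by apply: sumr_ge0 => i _; exact: sqr_ge0.
have B0 : 0 <= B by apply: sumr_ge0 => i _; exact: sqr_ge0.
have key (t : R) : 0 <= A * t ^+ 2 - 2 * t * D + B.
  have -> : A * t ^+ 2 - 2 * t * D + B = \sum_(i | P i) (f i * t - g i) ^+ 2.
    rewrite /A /B /D mulr_suml mulr_sumr -sumrN -!big_split /=.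
    apply: eq_bigr => i _; ring.
  by apply: sumr_ge0 => i _; exact: sqr_ge0.
have [A_eq0|A_neq0] := eqVneq A 0.
  have h0 i : P i -> f i = 0.
    move=> Pi; apply/eqP; rewrite -sqrf_eq0.
    have := @psumr_eq0P _ _ P (fun i => f i ^+ 2) (fun i _ => sqr_ge0 _) A_eq0 i Pi.
    by move=> ->.
  by rewrite A_eq0 mul0r /D big1 ?expr0n// => i Pi; rewrite h0// mul0r.
have Ap : 0 < A by rewrite lt_neqAle eq_sym A_neq0.
have := key (D / A).
have -> : A * (D / A) ^+ 2 - 2 * (D / A) * D + B = (A * B - D ^+ 2) / A by field.
by rewrite pmulr_lge0 ?invr_gt0// subr_ge0.
Qed.

Section Parseval.
Local Open Scope complex_scope.
Variable R : realType.
Implicit Types p q : {poly R[i]}.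

Definition uroot (N t : nat) : R[i] := expi (t%:R * (2 * pi / N%:R)).

Lemma normc_uroot N t : normc (uroot N t) = 1.
Proof. exact: normc_expi. Qed.

Lemma uroot_expr N t m : uroot N t ^+ m = uroot N m ^+ t.
Proof. by rewrite /uroot -!expiX exprAC. Qed.

Lemma uroot_exprN N t : (0 < N)%N -> uroot N t ^+ N = 1.
Proof.
move=> N0; rewrite /uroot -expiX exprAC expiX.
by rewrite mulrC divfK ?pnatr_eq0 -?lt0n// expi_2pi expr1n.
Qed.

Lemma uroot_inj N : {in gtn N &, injective (uroot N)}.
Proof.
have wlg m n : (m < n)%N -> (n < N)%N -> uroot N m != uroot N n.
  move=> mn nN; have N0 : (0 < N)%N by apply: leq_ltn_trans nN.
  rewrite -subr_eq0; apply/eqP => /(congr1 (@normc R)); rewrite normc0 normcB_sym.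
  rewrite normc_expiB => /eqP; rewrite mulf_eq0 pnatr_eq0 /= normr_eq0; apply/negP.
  have -> : (n%:R * (2 * pi / N%:R) - m%:R * (2 * pi / N%:R)) / 2
            = pi * ((n - m)%:R / N%:R) :> R.
    by rewrite natrB ?(ltnW mn)//; field; rewrite pnatr_eq0 -lt0n.
  rewrite gt_eqF// sin_gt0_pi// mulr_gt0 ?pi_gt0 ?divr_gt0 ?ltr0n ?subn_gt0//=.
  rewrite gtr_pMr ?pi_gt0// ltr_pdivrMr ?ltr0n// mul1r ltr_nat.
  by rewrite (leq_ltn_trans _ nN)// leq_subr.
move=> m n; rewrite !inE => mN nN e; case: (ltngtP m n) => // mn.
  by have := wlg _ _ mn nN; rewrite e eqxx.
by have := wlg _ _ mn mN; rewrite e eqxx.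
Qed.

Lemma uroot_orthogonal N (m n : 'I_N) :
  \sum_(t < N) uroot N t ^+ m * (uroot N t ^+ n)^*%C = (N * (m == n))%:R.
Proof.
have N0 : (0 < N)%N by apply: leq_ltn_trans (ltn_ord m).
set w := uroot N m * (uroot N n)^*%C.
have wE t : uroot N t ^+ m * (uroot N t ^+ n)^*%C = w ^+ t.
  by rewrite uroot_expr [in X in X^*%C]uroot_expr rmorphXn -exprMn.
under eq_bigr do rewrite wE.
have [mn|mn] := eqVneq m n.
  rewrite /w mn expi_conjM; under eq_bigr do rewrite expr1n.
  by rewrite sumr_const card_ord muln1.
rewrite muln0; have w1 : w != 1.
  apply: contra mn => /eqP /(congr1 (fun x => x * uroot N n)).
  rewrite -mulrA [_^*%C * _]mulrC expi_conjM mulr1 mul1r => /uroot_inj e.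
  by apply/eqP/val_inj/e; rewrite inE.
(* A geometric sum with ratio w != 1 and w^N = 1 vanishes. *)
apply: (mulfI (_ : w - 1 != 0)); first by rewrite subr_eq0.
by rewrite -subrX1 exprMn -rmorphXn !uroot_exprN// rmorph1 mulr1 subrr mulr0.
Qed.

Lemma parseval N p : (size p <= N)%N ->
  \sum_(t < N) normc p.[uroot N t] ^+ 2 = N%:R * \sum_(m < N) normc p`_m ^+ 2.
Proof.
move=> pN; apply: (@complexI R);
rewrite rmorphM /= !rmorph_sum /= (rmorph_nat (real_complex R)).
under eq_bigr do rewrite sqr_normc_conj (horner_coef_wide _ pN) rmorph_sum /= mulr_suml.
rewrite exchange_big /= mulr_sumr; apply: eq_bigr => m _.
under eq_bigr do rewrite mulr_sumr.
rewrite exchange_big /= (bigD1 m)//= [X in _ + X]big1 => [|n nm].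
  under eq_bigr do rewrite rmorphM /= mulrACA.
  rewrite -mulr_sumr uroot_orthogonal eqxx muln1 addr0 mulrC; congr (_ * _).
  by rewrite -sqr_normc_conj.
under eq_bigr do rewrite rmorphM /= mulrACA.
by rewrite -mulr_sumr uroot_orthogonal eq_sym (negbTE nm) muln0 mulr0.
Qed.

End Parseval.

(** * The Dirichlet kernel *)

Section Dirichlet.
Local Open Scope complex_scope.
Variable R : realType.
Implicit Types (z w : R[i]) (p q : {poly R[i]}) (P N : nat).

(** One-sided, so as to be a polynomial, and scaled to be 1 at its centre z when |z| = 1. *)
Definition dirichlet z P : {poly R[i]} :=
  \poly_(i < P.+1) (P.+1%:R^-1 * (z^*%C) ^+ i).

Lemma normc_nat n : normc (n%:R : R[i]) = n%:R.
Proof. by rewrite -(rmorph_nat (real_complex R)) normc_real ger0_norm. Qed.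

Lemma conjcM_unit z : normc z = 1 -> z^*%C * z = 1.
Proof. by move=> z1; rewrite mulrC -sqr_normc_conj z1 expr1n. Qed.

Lemma dirichletE z P w :
  (dirichlet z P).[w] = P.+1%:R^-1 * \sum_(i < P.+1) (z^*%C * w) ^+ i.
Proof.
by rewrite horner_poly mulr_sumr; apply: eq_bigr => i _; rewrite exprMn mulrA.
Qed.

Lemma dirichlet_center z P : normc z = 1 -> (dirichlet z P).[z] = 1.
Proof.
move=> z1; rewrite dirichletE conjcM_unit//; under eq_bigr do rewrite expr1n.
by rewrite sumr_const card_ord mulVf// pnatr_eq0.
Qed.

Lemma dirichlet_le1 z P w : normc z = 1 -> normc w = 1 ->
  normc (dirichlet z P).[w] <= 1.
Proof.
move=> z1 w1; rewrite dirichletE normcM normcV normc_nat mulrC.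
rewrite ler_pdivrMr ?ltr0n// mul1r; apply: le_trans (ler_normc_sum _ _ _) _.
under eq_bigr do rewrite normcX normcM normc_conj z1 w1 mulr1 expr1n.
by rewrite sumr_const card_ord.
Qed.

(** The factor w - z clears the denominator of the geometric sum and leaves r^(P+1) - 1 with |r| =
    1. The product form also covers w = z. *)
Lemma dirichlet_decay z P w : normc z = 1 -> normc w = 1 ->
  normc (dirichlet z P).[w] * (P.+1%:R * normc (w - z)) <= 2.
Proof.
move=> z1 w1.
have -> : normc (w - z) = normc (z^*%C * w - 1).
  by rewrite -[1](conjcM_unit z1) -mulrBr normcM normc_conj z1 mul1r.
rewrite mulrCA -normcM -(normc_nat P.+1) -normcM dirichletE.
rewrite -mulrA mulVKf ?pnatr_eq0// mulrC -subrX1.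
apply: le_trans (ler_normcD _ _) _.
by rewrite normcN normc1 normcX normcM normc_conj z1 w1 mulr1 expr1n.
Qed.

Lemma dirichlet_norm z P N : (P < N)%N -> normc z = 1 ->
  \sum_(m < N) normc (dirichlet z P)`_m ^+ 2 = P.+1%:R^-1 :> R.
Proof.
move=> PN z1.
rewrite (eq_bigr (fun m : 'I_N => if (m < P.+1)%N then P.+1%:R^-1 ^+ 2 else 0)).
  rewrite -big_mkcond -(big_ord_widen N (fun=> P.+1%:R^-1 ^+ 2 : R))//.
  by rewrite sumr_const card_ord -[LHS]mulr_natl expr2 mulVKf// pnatr_eq0.
move=> m _; rewrite coef_poly; case: ifP => _; last by rewrite normc0 expr0n.
by rewrite normcM normcV normc_nat normcX normc_conj z1 expr1n mulr1.
Qed.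

(** By Parseval at the N-th roots of unity, both sides become sums of values on the circle, where
    |p| <= g. *)
Lemma sum_coef_mul_le p q N g : (size (p * q)%R <= N)%N -> (size q <= N)%N ->
  (forall w, normc w = 1 -> normc p.[w] <= g) ->
  \sum_(m < N) normc (p * q)`_m ^+ 2 <= g ^+ 2 * \sum_(m < N) normc q`_m ^+ 2.
Proof.
case: N => [|N]; first by rewrite !big_ord0 mulr0.
move=> pqN qN pg; rewrite -(@ler_pM2l _ N.+1%:R) ?ltr0n// mulrCA -!parseval//.
rewrite mulr_sumr; apply: ler_sum => t _; rewrite hornerM normcM exprMn.
rewrite ler_wpM2r ?sqr_ge0// lerXn2r ?nnegrE ?normc_ge0 ?pg ?normc_uroot//.
by apply: le_trans (pg 1 (normc1 R)); exact: normc_ge0.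
Qed.

(** One kernel factor supplies the l2 norm; the other n have modulus at most 1 on the circle. *)
Lemma sum_coef_mul_dirichlet_le p z P n N g : (P < N)%N -> normc z = 1 ->
  (size (p * dirichlet z P ^+ n.+1)%R <= N)%N ->
  (forall w, normc w = 1 -> normc p.[w] <= g) ->
  \sum_(m < N) normc (p * dirichlet z P ^+ n.+1)`_m ^+ 2 <= g ^+ 2 / P.+1%:R.
Proof.
move=> PN z1; rewrite exprSr mulrA => pN pg.
rewrite -(@dirichlet_norm z P N)//; apply: sum_coef_mul_le => //.
  exact: leq_trans (size_poly _ _) _.
move=> w w1; rewrite hornerM normcM horner_exp normcX.
apply: le_trans (pg w w1); rewrite ler_piMr ?normc_ge0//.
by rewrite exprn_ile1 ?normc_ge0 ?dirichlet_le1.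
Qed.

(* [D ^ 4] is the square of [D ^ 2], so by Cauchy-Schwarz its coefficients are at
   most the squared l2 norm of those of [D ^ 2]. *)
Lemma coef_dirichlet_exp4 P m :
  normc (dirichlet 1 P ^+ 4)`_m <= P.+1%:R^-1.
Proof.
set q := dirichlet 1 P ^+ 2; pose N := (size q + m + P.+1)%N.
have -> : dirichlet 1 P ^+ 4 = q * q by rewrite /q -exprD.
have qN : \sum_(i < N) normc q`_i ^+ 2 <= P.+1%:R^-1.
  have := @sum_coef_mul_dirichlet_le 1 1 P 1 N 1.
  rewrite mul1r expr1n mul1r -/q; apply; rewrite ?normc1 // /N; try lia.
  by move=> w w1; rewrite hornerC normc1.
have Q0 n : 0 <= \sum_(i < n) normc q`_i ^+ 2.
  by apply: sumr_ge0 => i _; exact: sqr_ge0.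
have QN : \sum_(i < m.+1) normc q`_i ^+ 2 <= \sum_(i < N) normc q`_i ^+ 2.
  rewrite -!(big_mkord xpredT (fun i => normc q`_i ^+ 2)).
  rewrite (big_cat_nat (n := m.+1) (p := N))//= ?lerDl.
    by apply: sumr_ge0 => i _; exact: sqr_ge0.
  by rewrite /N; lia.
rewrite coefM; apply: le_trans (ler_normc_sum _ _ _) _.
under eq_bigr do rewrite normcM.
apply: (le_trans _ qN); apply: (le_trans _ QN).
rewrite -(@ler_pXn2r _ 2) ?nnegrE//; last first.
  by apply: sumr_ge0 => i _; rewrite mulr_ge0 ?normc_ge0.
have /le_trans := @sum_CauchySchwarz R 'I_m.+1 xpredT
  (fun i => normc q`_i) (fun i => normc q`_(m - i)).
apply.
rewrite expr2 ler_wpM2l ?Q0// le_eqVlt; apply/orP; left; apply/eqP.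
by rewrite [RHS](reindex_inj rev_ord_inj) /=; apply: eq_bigr => i _; rewrite subSS.
Qed.

End Dirichlet.

(** * Duality *)

Section Duality.
Local Open Scope complex_scope.
Variable R : realType.

Definition node S (omega : 'I_S -> R) (j : 'I_S) : R[i] :=
  expi (- (2 * pi * omega j)).

Lemma normc_node S (omega : 'I_S -> R) j : normc (node omega j) = 1.
Proof. exact: normc_expi. Qed.

Lemma PhiE S (omega : 'I_S -> R) M m j : Phi omega M m j = node omega j ^+ m.
Proof. by rewrite mxE /node expiX; congr expi; ring. Qed.

Lemma mul_PhiE S (omega : 'I_S -> R) M (v : 'cV[R[i]]_S) m :
  (Phi omega M *m v) m ord0 = \sum_j v j ord0 * node omega j ^+ m.
Proof. by rewrite mxE; apply: eq_bigr => j _; rewrite PhiE mulrC. Qed.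

Lemma sqr_l2norm n (v : 'cV[R[i]]_n) :
  l2norm v ^+ 2 = \sum_(i < n) normc (v i ord0) ^+ 2.
Proof. by rewrite sqr_sqrtr// sumr_ge0// => i _; exact: sqr_ge0. Qed.

Lemma l2norm_ge0 n (v : 'cV[R[i]]_n) : 0 <= l2norm v.
Proof. exact: sqrtr_ge0. Qed.

(** A lower bound passes to [inf] of a nonempty set; for n > 0 a basis vector lies on the unit
    sphere. *)
Lemma sigma_min_ge m n (P : 'M[R[i]]_(m, n)) (b : R) : (0 < n)%N ->
  (forall v, l2norm v = 1 -> b <= l2norm (P *m v)) -> b <= sigma_min P.
Proof.
move=> n0 hb; apply: lb_le_inf; last by move=> _ [v /= v1 <-]; exact: hb.
pose k := Ordinal n0; pose v : 'cV[R[i]]_n := delta_mx k ord0.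
exists (l2norm (P *m v)), v => //=.
rewrite /l2norm (bigD1 k)//= big1 ?addr0 => [|i ik]; last first.
  by rewrite mxE (negbTE ik) (normc0 R) expr0n.
by rewrite mxE !eqxx (normc1 R) expr1n sqrtr1.
Qed.

(** For E the identity the form is |v|^2 = 1; the error is at most e (sum |v_k|)^2 <= S e by
    Cauchy-Schwarz. *)
Lemma quadratic_form_ge S (v : 'cV[R[i]]_S) (E : 'I_S -> 'I_S -> R[i]) (e : R) :
  l2norm v = 1 -> (forall j k, normc (E j k - (j == k)%:R) <= e) ->
  1 - S%:R * e
    <= normc (\sum_k \sum_j v k ord0 * (v j ord0)^*%C * E j k).
Proof.
move=> v1 Ee; pose a k := normc (v k ord0).
have a2 : \sum_k a k ^+ 2 = 1 by rewrite -sqr_l2norm v1 expr1n.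
have as2 : (\sum_k a k) ^+ 2 <= S%:R.
  have := sum_CauchySchwarz xpredT a (fun=> 1).
  under eq_bigr do rewrite mulr1.
  move=> /le_trans; apply; rewrite a2 mul1r.
  under eq_bigr do rewrite expr1n.
  by rewrite sumr_const card_ord.
set X := \sum_k _.
set Y := \sum_k \sum_j v k ord0 * (v j ord0)^*%C * (E j k - (j == k)%:R).
have XY : X = 1 + Y.
  have -> : 1 = \sum_k \sum_j v k ord0 * (v j ord0)^*%C * (j == k)%:R :> R[i].
    rewrite -[LHS](rmorph1 (real_complex R)) -a2 rmorph_sum /=.
    apply: eq_bigr => k _; rewrite (bigD1 k)//= eqxx mulr1 big1 ?addr0.
      exact: sqr_normc_conj.
    by move=> j jk; rewrite (negbTE jk) mulr0.
  rewrite /X /Y -big_split /=; apply: eq_bigr => k _.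
  by rewrite -big_split /=; apply: eq_bigr => j _; rewrite -mulrDr addrC subrK.
have YS : normc Y <= S%:R * e.
  apply: le_trans (ler_normc_sum _ _ _) _.
  apply: (@le_trans _ _ (\sum_k \sum_j a k * a j * e)).
    apply: ler_sum => k _; apply: le_trans (ler_normc_sum _ _ _) _.
    apply: ler_sum => j _; rewrite !normcM normc_conj ler_wpM2l//.
    by rewrite mulr_ge0 ?normc_ge0.
  have e0 : (0 < S)%N -> 0 <= e.
    by move=> S0; apply: le_trans (Ee (Ordinal S0) (Ordinal S0)); exact: normc_ge0.
  have -> : \sum_k \sum_j a k * a j * e = (\sum_k a k) ^+ 2 * e.
    rewrite expr2 mulr_suml mulr_suml; apply: eq_bigr => k _.
    by rewrite mulr_sumr mulr_suml.
  (* The sign of e is known only through an entry of E, so S = 0 is treated apart. *)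
  case: S v E e v1 Ee a a2 as2 X Y XY e0 => [|n] v E e v1 Ee a a2 as2 X Y XY e0.
    by rewrite big_ord0 expr0n !mul0r.
  by rewrite ler_wpM2r// e0.
have := ler_normcD X (- Y).
rewrite {1}XY addrK normc1 normcN; lra.
Qed.

Lemma duality S (omega : 'I_S -> R) M (v : 'cV[R[i]]_S)
    (H : 'I_S -> {poly R[i]}) (e : R) : l2norm v = 1 ->
  (forall j, size (H j) <= M.+1)%N ->
  (forall j k, normc ((H j).[node omega k] - (j == k)%:R) <= e) ->
  1 - S%:R * e
    <= Num.sqrt (\sum_j \sum_(m < M.+1) normc (H j)`_m ^+ 2)
       * l2norm (Phi omega M *m v).
Proof.
move=> v1 sH He; apply: le_trans (quadratic_form_ge v1 He) _.
pose p m : R[i] := \sum_j (v j ord0)^*%C * (H j)`_m.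
have -> : \sum_k \sum_j v k ord0 * (v j ord0)^*%C * (H j).[node omega k]
          = \sum_(m < M.+1) p m * (Phi omega M *m v) m ord0.
  under [RHS]eq_bigr do rewrite mul_PhiE mulr_sumr.
  rewrite [RHS]exchange_big; apply: eq_bigr => k _ /=.
  under [RHS]eq_bigr do rewrite mulr_suml.
  rewrite [RHS]exchange_big; apply: eq_bigr => j _ /=.
  rewrite (horner_coef_wide _ (sH j)) mulr_sumr; apply: eq_bigr => m _; ring.
apply: le_trans (ler_normc_sum _ _ _) _; under eq_bigr do rewrite normcM.
have S0 : 0 <= \sum_j \sum_(m < M.+1) normc (H j)`_m ^+ 2.
  by apply: sumr_ge0 => j _; apply: sumr_ge0 => m _; exact: sqr_ge0.
rewrite -(@ler_pXn2r _ 2) ?nnegrE ?mulr_ge0 ?sqrtr_ge0//; last first.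
  by apply: sumr_ge0 => m _; rewrite mulr_ge0 ?normc_ge0.
rewrite exprMn sqr_sqrtr// sqr_l2norm.
have /le_trans := @sum_CauchySchwarz R 'I_M.+1 xpredT
  (fun m => normc (p m)) (fun m => normc ((Phi omega M *m v) m ord0)).
apply; rewrite ler_wpM2r//; first by apply: sumr_ge0 => m _; exact: sqr_ge0.
(* Cauchy-Schwarz in j for each fixed m, with |v| = 1, bounds |p|^2 by the sum of the squared norms
   of the H_j. *)
rewrite exchange_big; apply: ler_sum => m _ /=.
rewrite -[leRHS]mul1r -[X in _ <= X * _](expr1n _ 2) -v1 sqr_l2norm.
apply: (@le_trans _ _ ((\sum_j normc (v j ord0) * normc (H j)`_m) ^+ 2)); last first.
  exact: (@sum_CauchySchwarz R _ xpredT (fun j => normc (v j ord0))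
                                        (fun j => normc (H j)`_m)).
rewrite lerXn2r ?nnegrE ?normc_ge0//.
  by apply: sumr_ge0 => j _; rewrite mulr_ge0 ?normc_ge0.
apply: le_trans (ler_normc_sum _ _ _) _.
by apply: ler_sum => j _; rewrite normcM normc_conj.
Qed.

(** Expanding sum_m W_m |(Phi v)_m|^2 gives the form with entries W(z_k conj(z_j)), and the weights
    have modulus at most c. *)
Lemma weighted_gram S (omega : 'I_S -> R) M (v : 'cV[R[i]]_S)
    (W : {poly R[i]}) (c e : R) : l2norm v = 1 ->
  (size W <= M.+1)%N -> (forall m, normc W`_m <= c) ->
  (forall j k, normc (W.[node omega k * (node omega j)^*%C] - (j == k)%:R) <= e) ->
  1 - S%:R * e <= c * l2norm (Phi omega M *m v) ^+ 2.
Proof.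
move=> v1 sW Wc We; apply: le_trans (quadratic_form_ge v1 We) _.
set F := fun m : 'I_M.+1 => (Phi omega M *m v) m ord0.
have -> : \sum_k \sum_j v k ord0 * (v j ord0)^*%C
                        * W.[node omega k * (node omega j)^*%C]
          = \sum_(m < M.+1) W`_m * (F m * (F m)^*%C).
  under [RHS]eq_bigr => m _.
    rewrite /F mul_PhiE rmorph_sum big_distrlr mulr_sumr /=.
    under eq_bigr do rewrite mulr_sumr.
    over.
  rewrite [RHS]exchange_big; apply: eq_bigr => k _ /=.
  rewrite [RHS]exchange_big; apply: eq_bigr => j _ /=.
  rewrite (horner_coef_wide _ sW) mulr_sumr; apply: eq_bigr => m _.
  by rewrite rmorphM rmorphXn exprMn /=; ring.
apply: le_trans (ler_normc_sum _ _ _) _.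
rewrite sqr_l2norm mulr_sumr; apply: ler_sum => m _.
by rewrite !normcM normc_conj -expr2 ler_wpM2r ?sqr_ge0.
Qed.

End Duality.

(** * Distances on the torus *)

Section Torus.
Local Open Scope complex_scope.
Variable R : realType.
Implicit Types (x y : R).

Lemma tnorm_le x (n : int) : tnorm x <= `|x - n%:~R|.
Proof.
apply: ge_inf; last by exists n.
by exists 0 => _ [m _ <-]; exact: normr_ge0.
Qed.

Lemma expi_2pi_int (n : int) : expi (2 * pi * n%:~R) = 1 :> R[i].
Proof.
have expi_nat (m : nat) : expi (2 * pi * m%:R) = 1 :> R[i].
  by rewrite mulrC -expiX expi_2pi expr1n.
case: n => m; first exact: expi_nat.
by rewrite NegzE mulrNz mulrN expiN expi_nat rmorph1.
Qed.

Lemma expi_shift x (n : int) : expi (- (2 * pi * (x + n%:~R))) = expi (- (2 * pi * x)).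
Proof. by rewrite mulrDr opprD expiD [X in _ * X]expiN expi_2pi_int rmorph1 mulr1. Qed.

Lemma normc_expiB_sin (q : nat) x y :
  normc (expi (- (2 * pi * x)) ^+ q - expi (- (2 * pi * y)) ^+ q)
  = 2 * `|sin (pi * q%:R * `|x - y|)|.
Proof.
have abs_sin (t : R) : `|sin t| = `|sin `|t| |.
  by case: (ger0P t) => // _; rewrite sinN normrN.
rewrite !expiX normc_expiB; congr (2 * _).
have -> : (q%:R * - (2 * pi * x) - q%:R * - (2 * pi * y)) / 2
          = - (pi * q%:R * (x - y)) by field.
rewrite sinN normrN [LHS]abs_sin normrM.
by rewrite [`|pi * _|]ger0_norm ?mulr_ge0 ?pi_ge0 ?ler0n.
Qed.

(** An integer shift of x to z gives |z - y| <= 1/2. The chord is then 2 |sin(pi |z - y|)|; sin t >=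
    0.57 t for 0 <= t <= 1.6 and pi > 2.8 give a factor 3.19. *)
Lemma normc_expiB_ge_tnorm x y :
  3 * tnorm (x - y) <= normc (expi (- (2 * pi * x)) - expi (- (2 * pi * y))).
Proof.
pose n := Num.floor (x - y + 2^-1); pose z := x - n%:~R.
have -> : x = z + n%:~R by rewrite subrK.
rewrite expi_shift; have zy : `|z - y| <= 2^-1.
  have := floor_le (x - y + 2^-1); have := floorD1_gt (x - y + 2^-1).
  rewrite -/n intrD /z ler_norml => h1 h2; apply/andP; split; lra.
have := tnorm_le (z + n%:~R - y) n; rewrite addrAC addrK => tn.
have := normc_expiB_sin 1 z y; rewrite !expr1 mulr1 => ->.
have p1 := pi_gt_28 R; have p2 := pi_lt_32 R.
have u0 : 0 <= `|z - y| by [].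
set t := pi * `|z - y|.
have t0 : 0 <= t by rewrite mulr_ge0 ?pi_ge0.
have t16 : t <= 16 / 10 by rewrite /t; nra.
have t28 : 28 / 10 * `|z - y| <= t by rewrite /t; nra.
have s1 : t * (57 / 100) <= sin t.
  apply: le_trans (sin_ge_cubic t0); rewrite !exprS expr0.
  have : t * t <= 256 / 100 by nra.
  by nra.
by have := ler_norm (sin t); lra.
Qed.

End Torus.

(** * Separated points on the line *)

Section Sorting.
Variables (R : realDomainType) (I : finType).

(** Sort by x: consecutive gaps are at least h, and they add up. *)
Lemma sorted_enum_gap (L : {set I}) (x : I -> R) (h : R) :
  {in L &, forall j k, j != k -> h <= `|x j - x k|} ->
  exists2 s : seq I, perm_eq s (enum L) &
    forall i0 p q, (p < q < #|L|)%N ->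
      h *+ (q - p) <= x (nth i0 s q) - x (nth i0 s p).
Proof.
move=> hsep; pose r := relpre x <=%R; pose s := sort r (enum L).
have ps : perm_eq s (enum L) by rewrite perm_sort.
exists s => // i0 p q /andP[pq ql].
have r_tot : total r by move=> j k; exact: le_total.
have r_trans : transitive r by move=> j k l; exact: le_trans.
have us : uniq s by rewrite (perm_uniq ps) enum_uniq.
have sz : size s = #|L| by rewrite (perm_size ps) -cardE.
have inL p' : (p' < #|L|)%N -> nth i0 s p' \in L.
  by move=> h'; rewrite -mem_enum -(perm_mem ps) mem_nth// sz.
have step p' : (p'.+1 < #|L|)%N -> h <= x (nth i0 s p'.+1) - x (nth i0 s p').
  move=> h'; have h'' := ltnW h'.
  have le_x : x (nth i0 s p') <= x (nth i0 s p'.+1).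
    have srt : sorted r s by exact: sort_sorted.
    by apply: (sorted_ltn_nth r_trans i0 srt); rewrite ?inE ?sz.
  rewrite -(ger0_norm (_ : 0 <= _ - _)) ?subr_ge0// hsep ?inL//.
  by rewrite nth_uniq ?sz// gtn_eqF.
elim: q pq ql => // q IH; rewrite ltnS leq_eqVlt => /predU1P[<-|pq] ql.
  by rewrite subSnn mulr1n step.
rewrite subSn ?(ltnW pq)// mulrS -(subrK (x (nth i0 s q)) (x (nth i0 s q.+1))).
by rewrite -addrA lerD ?step ?IH// ltnW.
Qed.

End Sorting.

(** After sorting, the p-th and q-th points are at least h |p - q| apart, so each factor is bounded
    by its value for equispaced points with gap h. *)
Lemma sum_prod_separated_le (R : realFieldType) (I : finType) (L : {set I})
    (x : I -> R) (d : I -> I -> R) (h K : R) : 0 < h -> 0 < K ->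
  {in L &, forall j k, j != k -> h <= `|x j - x k|} ->
  {in L &, forall j k, j != k -> K * `|x j - x k| <= d j k} ->
  \sum_(j in L) (\prod_(k in L | k != j) (d j k)^-1) ^+ 2
  <= ((K * h) ^+ 2)^-1 ^+ (#|L| - 1)
     * \sum_(1 <= j < #|L|.+1) \prod_(1 <= k < #|L|.+1 | k != j)
          ((j%:R - k%:R) ^+ 2)^-1.
Proof.
move=> h0 K0 hsep hd; have [s ps gap] := sorted_enum_gap hsep.
have us : uniq s by rewrite (perm_uniq ps) enum_uniq.
have sz : size s = #|L| by rewrite (perm_size ps) -cardE.
have [->|/set0Pn[i0 i0L]] := eqVneq L finset.set0.
  by rewrite big_set0 cards0 big_geq// mulr0.
set l := #|L| in sz gap *.
have inL p : (p < l)%N -> nth i0 s p \in L.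
  by move=> h'; rewrite -mem_enum -(perm_mem ps) mem_nth// sz.
have -> : \sum_(j in L) (\prod_(k in L | k != j) (d j k)^-1) ^+ 2
  = \sum_(0 <= p < l) (\prod_(0 <= q < l | q != p)
                          (d (nth i0 s p) (nth i0 s q))^-1) ^+ 2.
  rewrite -big_enum -(perm_big _ ps) /= (big_nth i0) sz.
  rewrite big_nat [RHS]big_nat; apply: eq_bigr => p /= pl; congr (_ ^+ 2).
  rewrite -big_enum_cond /= -(perm_big _ ps) /= (big_nth i0) sz.
  rewrite big_nat_cond [RHS]big_nat_cond; apply: eq_bigl => q.
  by case: (ltnP q l) => //= ql; rewrite nth_uniq ?sz.
rewrite big_add1 /= mulr_sumr !big_mkord; apply: ler_sum => p _.
rewrite big_add1 /= !big_mkord.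
have card_p : #|[pred q : 'I_l | q != p :> nat]| = (l - 1)%N.
  have -> : #|[pred q : 'I_l | q != p :> nat]| = #|predC1 p| by apply: eq_card => q.
  by rewrite cardC1 card_ord subn1.
rewrite -card_p -prodr_const -big_split /= -prodrXl.
apply: ler_prod => q qp; rewrite sqr_ge0 /= -exprVn -exprVn -exprMn.
(* Here t = |p - q|; the shift of the indices by one cancels. *)
have [t t0 [tE tx]] : exists2 t : R, 0 < t & (p.+1%:R - q.+1%:R) ^+ 2 = t ^+ 2
    /\ h * t <= `|x (nth i0 s p) - x (nth i0 s q)|.
  case: (ltngtP p q) => [pq|qlp|/esym/eqP]; last by rewrite (negbTE qp).
    exists (q - p)%:R; first by rewrite ltr0n subn_gt0.
    split; first by rewrite natrB 1?ltnW// -!natr1; ring.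
    rewrite mulr_natr distrC (le_trans (gap i0 p q _)) ?ler_norm// pq /=.
    exact: ltn_ord.
  exists (p - q)%:R; first by rewrite ltr0n subn_gt0.
  split; first by rewrite natrB 1?ltnW// -!natr1; ring.
  rewrite mulr_natr (le_trans (gap i0 q p _)) ?ler_norm// qlp /=.
  exact: ltn_ord.
rewrite exprMn exprVn [X in _ * X]exprVn tE -!exprVn -exprMn -invfM.
have Kht : 0 < K * h * t by rewrite !mulr_gt0.
have dKht : K * h * t <= d (nth i0 s p) (nth i0 s q).
  apply: le_trans (hd _ _ (inL _ (ltn_ord p)) (inL _ (ltn_ord q)) _).
    by rewrite -mulrA ler_wpM2l// ltW.
  by rewrite nth_uniq ?sz// eq_sym.
have d0 := lt_le_trans Kht dKht.
by rewrite lerXn2r ?nnegrE ?invr_ge0 ?lef_pV2 ?posrE// ltW.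
Qed.

(** * Lagrange interpolation on a clump *)

Section Lagrange.
Local Open Scope complex_scope.
Variables (R : realType) (I : finType).
Implicit Types (u : I -> R[i]) (L : {set I}) (Q P : nat).

(** Halved because |X^Q - u_k^Q| <= 2 on the circle: the inverse then bounds a whole Lagrange
    factor. *)
Definition half_chord u Q j k : R := normc (u j ^+ Q - u k ^+ Q) / 2.

(* The power [Q] spreads the nodes of a clump apart. *)
Definition lagrange u L Q j : {poly R[i]} :=
  \prod_(k in L | k != j) ((u j ^+ Q - u k ^+ Q)^-1 *: ('X^Q - (u k ^+ Q)%:P)).

Lemma size_lagrange u L Q j : j \in L ->
  (size (lagrange u L Q j) <= (Q * (#|L| - 1)).+1)%N.
Proof.
move=> jL; apply: leq_trans (size_poly_prod_leq _ _) _.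
have cL : #|[pred k | (k \in L) && (k != j)]| = (#|L| - 1)%N.
  rewrite [in RHS](cardsD1 j) jL addnC addnK; apply: eq_card => k.
  by rewrite !inE andbC.
rewrite -cL; set n := #|_|.
suff h : (\sum_(k in L | k != j) size
    ((u j ^+ Q - u k ^+ Q)^-1 *: ('X^Q - (u k ^+ Q)%:P))%R <= n * Q.+1)%N.
  by rewrite leq_subLR; apply: leq_trans (_ : (n * Q.+1).+1 <= _)%N => //; lia.
rewrite -sum_nat_const; apply: leq_sum => k _.
apply: leq_trans (size_scale_leq _ _) _; apply: leq_trans (size_polyD _ _) _.
by rewrite size_polyXn size_polyN geq_max leqnn (leq_trans (size_polyC_leq1 _)).
Qed.

Lemma lagrange_self u L Q j :
  {in L, forall k, k != j -> u j ^+ Q != u k ^+ Q} ->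
  (lagrange u L Q j).[u j] = 1.
Proof.
move=> h; rewrite horner_prod big1// => k /andP[kL kj].
by rewrite !hornerE mulVf// subr_eq0 h.
Qed.

Lemma lagrange_other u L Q j k : k \in L -> k != j ->
  (lagrange u L Q j).[u k] = 0.
Proof.
move=> kL kj; rewrite horner_prod (bigD1 k) ?kL//= !hornerE.
by rewrite subrr mulr0 mul0r.
Qed.

Lemma normc_lagrange_le u L Q j w : (forall k, normc (u k) = 1) -> normc w = 1 ->
  normc (lagrange u L Q j).[w]
  <= \prod_(k in L | k != j) (half_chord u Q j k)^-1.
Proof.
move=> u1 w1; rewrite horner_prod normc_prod; apply: ler_prod => k _.
rewrite normc_ge0 /= /half_chord !hornerE normcM normcV invf_div mulrC.
rewrite ler_wpM2r ?invr_ge0 ?normc_ge0//; apply: le_trans (ler_normcD _ _) _.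
by rewrite normcN !normcX u1 w1 !expr1n.
Qed.

End Lagrange.

(** * The constant of a clump *)

Section Constants.
Variable R : realType.
Implicit Types l M : nat.

Lemma floor_divn M l : (Num.floor (M%:R / l%:R : R))%:~R = (M %/ l)%:R :> R.
Proof.
case: l => [|l]; first by rewrite invr0 mulr0 floor0 divn0.
rewrite (@floor_def _ _ (M %/ l.+1)%:Z)// -[_ + 1%R]/((M %/ l.+1 + 1)%N%:Z).
rewrite ler_pdivlMr ?ltr0n// ltr_pdivrMr ?ltr0n//.
by rewrite -!pmulrn -!natrM ler_nat ltr_nat leq_trunc_div addn1 ltn_ceil.
Qed.

(* [sin t >= t * sqrt (sine_loss l)] for [0 <= t <= pi / l]; the value is negative
   for [l = 1]. *)
Definition sine_loss l : R := 1 - pi ^+ 2 / (3 * l%:R ^+ 2).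

Lemma sine_loss_ge l : (1 < l)%N -> 14 / 100 <= sine_loss l.
Proof.
move=> l1; have p1 := pi_gt_28 R; have p2 := pi_lt_32 R.
have l2 : 2 <= l%:R :> R by rewrite (ler_nat _ 2).
have l4 : 4 <= l%:R ^+ 2 :> R by nra.
suff : pi ^+ 2 / (3 * l%:R ^+ 2) <= 86 / 100 :> R by rewrite /sine_loss; lra.
by rewrite ler_pdivrMr; nra.
Qed.

Lemma sine_loss_powR l :
  (sine_loss l `^ (- ((l - 1)%:R / 2))) ^+ 2 = (sine_loss l)^-1 ^+ (l - 1).
Proof.
(* For l <= 1 the exponent is 0 and both sides are 1, whatever the sign of the base. *)
case: l => [|[|l]]; try by rewrite subn1 /= mul0r oppr0 powRr0 expr1n expr0.
have s0 : 0 <= sine_loss l.+2 by have := @sine_loss_ge l.+2 isT; lra.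
rewrite powRN exprVn exprVn; congr (_^-1).
by rewrite -powR_mulrn ?powR_ge0// -powRrM divfK ?pnatr_eq0// powR_mulrn.
Qed.

(** The sum of the squared barycentric weights of the nodes 1, ..., l; it stands under the square
    root in [Cconst]. *)
Definition node_sum l : R :=
  \sum_(1 <= j < l.+1) \prod_(1 <= k < l.+1 | k != j) ((j%:R - k%:R) ^+ 2)^-1.

(** Squaring removes the roots; 800/361 is (20 sqrt 2 / 19)^2, and the powers of exponent l - 1
    merge since (M / l) (1 / Q) (l / pi) = M / (pi Q). The floor Q is positive because l <= M. *)
Lemma Cconst_sqr l M : (0 < l)%N -> (l <= M)%N ->
  Cconst R l M ^+ 2 = 800 / 361 * l%:R ^+ 2
    * (sine_loss l * (pi * (M %/ l)%:R / M%:R) ^+ 2)^-1 ^+ (l - 1) * node_sum l.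
Proof.
move=> l0 lM; set n := (l - 1)%N; set Q := (M %/ l)%N.
have Q0 : Q%:R != 0 :> R by rewrite pnatr_eq0 -lt0n divn_gt0.
have l0' : l%:R != 0 :> R by rewrite pnatr_eq0 -lt0n.
have M0 : M%:R != 0 :> R by rewrite pnatr_eq0 -lt0n (leq_trans l0).
have p0 : pi != 0 :> R by rewrite gt_eqF ?pi_gt0.
have s0 : 0 <= node_sum l.
  apply: sumr_ge0 => j _; apply: prodr_ge0 => k _.
  by rewrite invr_ge0 sqr_ge0.
rewrite /Cconst /Bconst floor_divn -/Q -/(sine_loss l) -/(node_sum l).
set w := sine_loss l `^ _.
have -> : 20 * Num.sqrt 2 / 19 * w * (M%:R / l%:R) ^+ n * Q%:R ^- n * l%:R
          * (l%:R / pi) ^+ n * Num.sqrt (node_sum l)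
        = 20 / 19 * l%:R * Num.sqrt 2 * Num.sqrt (node_sum l) * w
          * ((pi * Q%:R / M%:R)^-1 ^+ n).
  have -> : (pi * Q%:R / M%:R)^-1 = (M%:R / l%:R) * Q%:R^-1 * (l%:R / pi) :> R.
    move: (pi : R) (Q%:R : R) p0 Q0 => p q p0 q0.
    by field; rewrite p0 q0 l0' M0.
  rewrite !exprMn !exprVn; ring.
rewrite [LHS]exprMn [X in X * _]exprMn sine_loss_powR [X in X * _ * _]exprMn.
set x := pi * Q%:R / M%:R.
have xE : (x^-1 ^+ n) ^+ 2 = (x ^+ 2)^-1 ^+ n by rewrite exprAC exprVn.
have s2 : Num.sqrt 2 ^+ 2 = 2 :> R by rewrite sqr_sqrtr.
rewrite sqr_sqrtr// [X in X * _ * _ * _]exprMn s2 xE -/n.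
rewrite [(sine_loss l * _)^-1]invfM [(_ * (x ^+ 2)^-1) ^+ n]exprMn.
by set a := _ ^+ n; set b := _ ^+ n; field.
Qed.

End Constants.

(** * Chords and Lagrange weights within one clump *)

Section Clump.
Variable R : realType.
Implicit Types l M : nat.

(** As Q <= M / l, the angle pi Q |x - y| is at most pi / l, the range in which [sine_loss] controls
    sine. *)
Lemma expi_expB_ge l M (x y : R) : (1 < l)%N -> (l <= M)%N ->
  `|x - y| <= M%:R^-1 ->
  pi * (M %/ l)%:R * Num.sqrt (sine_loss R l) * `|x - y|
  <= normc (expi (- (2 * pi * x)) ^+ (M %/ l) - expi (- (2 * pi * y)) ^+ (M %/ l)) / 2.
Proof.
move=> l1 lM xyM; rewrite normc_expiB_sin [_ / 2]mulrC mulKf ?pnatr_eq0//.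
set t := pi * _ * `|x - y|; set c := Num.sqrt _.
have -> : pi * (M %/ l)%:R * c * `|x - y| = c * t by rewrite /t; ring.
apply: le_trans (ler_norm _).
have sl := sine_loss_ge R l1.
have l0 : 0 < l%:R :> R by rewrite ltr0n ltnW.
have M0 : 0 < M%:R :> R by rewrite ltr0n (leq_trans _ lM)// ltnW.
have t0 : 0 <= t by rewrite !mulr_ge0 ?pi_ge0.
have tl : t <= pi / l%:R.
  rewrite /t -mulrA ler_wpM2l ?pi_ge0//.
  apply: (@le_trans _ _ ((M %/ l)%:R * M%:R^-1)); first by rewrite ler_wpM2l.
  by rewrite ler_pdivrMr// mulrC ler_pdivlMr// -natrM ler_nat leq_trunc_div.
have t2 : t ^+ 2 <= pi ^+ 2 / l%:R ^+ 2.
  by rewrite -expr_div_n lerXn2r// nnegrE divr_ge0 ?pi_ge0// ltW.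
have slE : sine_loss R l = 1 - (pi ^+ 2 / l%:R ^+ 2) / 3.
  by rewrite /sine_loss invfM; field; rewrite gt_eqF.
apply: sin_ge_mul => //; first exact: sqrtr_ge0.
  lra.
rewrite sqr_sqrtr; lra.
Qed.

(** A cruder form of the same factor: pi^2 [sine_loss] l >= 2.8^2 * 0.14 > 1, and Q / M >= 1 / (2 l)
    because M < (Q + 1) l <= 2 Q l. *)
Lemma clump_factor_ge l M (a : R) : (1 < l)%N -> (l <= M)%N -> 0 <= a ->
  a / (2 * l%:R) <= pi * (M %/ l)%:R * Num.sqrt (sine_loss R l) * (a / M%:R).
Proof.
move=> l1 lM a0; set c := Num.sqrt _; set Q := (M %/ l)%N.
have l0 : 0 < l%:R :> R by rewrite ltr0n ltnW.
have M0 : 0 < M%:R :> R by rewrite ltr0n (leq_trans _ lM)// ltnW.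
have c0 : 0 <= c := sqrtr_ge0 _.
have p1 := pi_gt_28 R.
have pc : 1 <= pi * c.
  have sl := sine_loss_ge R l1.
  rewrite -(@ler_pXn2r _ 2) ?nnegrE ?mulr_ge0 ?pi_ge0// exprMn sqr_sqrtr; last lra.
  nra.
have QM : (2 * l%:R)^-1 <= Q%:R / M%:R :> R.
  rewrite ler_pdivlMr// mulrC ler_pdivrMr ?mulr_gt0// -!natrM ler_nat.
  have : (0 < Q)%N by rewrite divn_gt0// ltnW.
  have : (M < Q.+1 * l)%N by rewrite ltn_ceil// ltnW.
  nia.
have -> : pi * Q%:R * c * (a / M%:R) = a * (pi * c * (Q%:R / M%:R)) by ring.
rewrite ler_wpM2l//; apply: le_trans QM _.
by rewrite ler_peMl// divr_ge0.
Qed.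

Variables (S M : nat) (L : {set 'I_S}) (u : 'I_S -> R[i]) (x : 'I_S -> R) (alpha : R).
Hypotheses (alpha_gt0 : 0 < alpha) (L_gt0 : (0 < #|L|)%N) (L_leM : (#|L| <= M)%N).
Hypothesis uE : {in L, forall j, u j = expi (- (2 * pi * x j))}.
Hypothesis x_diam : {in L &, forall j k, `|x j - x k| <= M%:R^-1}.
Hypothesis x_sep : {in L &, forall j k, j != k -> alpha / M%:R <= `|x j - x k|}.

Local Notation d := (half_chord u (M %/ #|L|)).

Let card_gt1 j k : j \in L -> k \in L -> j != k -> (1 < #|L|)%N.
Proof. by move=> jL kL jk; apply/card_gt1P; exists j, k. Qed.

Lemma clump_dist_ge j k : j \in L -> k \in L -> j != k ->
  alpha / (2 * #|L|%:R) <= d j k.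
Proof.
move=> jL kL jk; have l1 := card_gt1 jL kL jk.
rewrite /half_chord !uE//; apply: le_trans (expi_expB_ge l1 L_leM (x_diam jL kL)).
apply: le_trans (clump_factor_ge l1 L_leM (ltW alpha_gt0)) _.
by rewrite ler_wpM2l ?x_sep// !mulr_ge0 ?pi_ge0 ?sqrtr_ge0.
Qed.

Lemma clump_nodes_neq j k : j \in L -> k \in L -> j != k ->
  u j ^+ (M %/ #|L|) != u k ^+ (M %/ #|L|).
Proof.
move=> jL kL jk; apply/eqP => e; have := clump_dist_ge jL kL jk.
rewrite /half_chord e subrr normc0 mul0r leNgt divr_gt0// mulr_gt0// ltr0n.
by [].
Qed.

Lemma clump_prod_le j : j \in L ->
  \prod_(k in L | k != j) (d j k)^-1 <= (2 * #|L|%:R / alpha) ^+ (#|L| - 1).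
Proof.
move=> jL.
have -> : (#|L| - 1)%N = #|[pred k | (k \in L) && (k != j)]|.
  rewrite (cardsD1 j) jL addnC addnK; apply: eq_card => k.
  by rewrite !inE andbC.
rewrite -prodr_const; apply: ler_prod => k /andP[kL kj].
have h := clump_dist_ge jL kL; rewrite eq_sym kj in h; have {}h := h isT.
have a0 : 0 < alpha / (2 * #|L|%:R) by rewrite divr_gt0// mulr_gt0// ltr0n.
rewrite invr_ge0 (le_trans (ltW a0) h) /= -invf_div lef_pV2 ?posrE//.
exact: lt_le_trans h.
Qed.

(** This sharp estimate produces C_a: with K = pi Q sqrt([sine_loss] l) and h = alpha / M, the
    square of K h is the base in [Cconst_sqr] times alpha^2. *)
Lemma clump_sum_le :
  800 / 361 * #|L|%:R ^+ 2 * \sum_(j in L) (\prod_(k in L | k != j) (d j k)^-1) ^+ 2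
  <= (Cconst R #|L| M * alpha ^- (#|L| - 1)) ^+ 2.
Proof.
have M0 : 0 < M%:R :> R by rewrite ltr0n (leq_trans _ L_leM).
have h0 : 0 < alpha / M%:R by rewrite divr_gt0.
have -> : (Cconst R #|L| M * alpha ^- (#|L| - 1)) ^+ 2
   = (800 / 361 * #|L|%:R ^+ 2) * ((sine_loss R #|L| * (pi * (M %/ #|L|)%:R / M%:R) ^+ 2
       * alpha ^+ 2)^-1 ^+ (#|L| - 1) * node_sum R #|L|).
  rewrite exprMn (Cconst_sqr R L_gt0 L_leM) -exprVn exprAC.
  have gen (p q : R) n : (p * q ^+ 2)^-1 ^+ n = p^-1 ^+ n * q^-1 ^+ 2 ^+ n.
    by rewrite invfM exprMn [q^-1 ^+ 2]exprVn.
  rewrite [in RHS](gen _ alpha).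
  by set c := 800 / 361 * _; set a := _ ^+ _; set b := _ ^+ _; ring.
have c0 : 0 <= 800 / 361 * #|L|%:R ^+ 2 :> R.
  by have := sqr_ge0 (#|L|%:R : R); lra.
suff : \sum_(j in L) (\prod_(k in L | k != j) (d j k)^-1) ^+ 2
   <= (sine_loss R #|L| * (pi * (M %/ #|L|)%:R / M%:R) ^+ 2
       * alpha ^+ 2)^-1 ^+ (#|L| - 1) * node_sum R #|L|.
  by move=> h; exact: (ler_wpM2l c0 h).
case: (ltnP 1 #|L|) => [l1|l1].
  set K := pi * (M %/ #|L|)%:R * Num.sqrt (sine_loss R #|L|).
  have sl := sine_loss_ge R l1.
  have K0 : 0 < K.
    rewrite /K mulr_gt0// ?mulr_gt0 ?pi_gt0 ?ltr0n ?divn_gt0// sqrtr_gt0; lra.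
  have hd : {in L &, forall j k, j != k -> K * `|x j - x k| <= d j k}.
    by move=> j k jL kL jk; rewrite /half_chord !uE//; exact: expi_expB_ge (x_diam _ _).
  have := sum_prod_separated_le h0 K0 x_sep hd.
  suff -> : (K * (alpha / M%:R)) ^+ 2
    = sine_loss R #|L| * (pi * (M %/ #|L|)%:R / M%:R) ^+ 2 * alpha ^+ 2 by [].
  rewrite /K; set c := Num.sqrt _.
  have <- : c ^+ 2 = sine_loss R #|L| by rewrite sqr_sqrtr//; lra.
  ring.
(* For a singleton [sine_loss] is negative, but all products are empty, so K = 1 serves. *)
have {}l1 : #|L| = 1%N by apply/eqP; rewrite eqn_leq l1.
have hd : {in L &, forall j k, j != k -> 1 * `|x j - x k| <= d j k}.
  by move=> j k jL kL /(card_gt1 jL kL); rewrite l1.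
have := sum_prod_separated_le h0 ltr01 x_sep hd.
by rewrite l1 !expr0.
Qed.

End Clump.

(** * The two cases of the theorem *)

Section Interpolation.
Local Open Scope complex_scope.
Variable R : realType.

Lemma model_separation (A M S : nat) (alpha beta : R) (omega : 'I_S -> R)
    (Lambda : 'I_A -> {set 'I_S}) j k :
  clumps_model_with_min_separation M beta alpha omega Lambda -> j != k ->
  alpha / M%:R <= tnorm (omega j - omega k).
Proof.
move=> /clumps_min_separation h jk; rewrite -lee_fin; apply: le_trans h _.
exact: (@bigmin_le_cond _ _ _ _ (j, k)).
Qed.

(** Each point is lifted to the real interval that holds its clump, so that arcs become intervals.
    The separation survives, as [tnorm] is at most the distance between any two lifts. *)
Lemma model_coordinates (A M S : nat) (alpha beta : R) (omega : 'I_S -> R)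
    (Lambda : 'I_A -> {set 'I_S}) :
  clumps_model_with_min_separation M beta alpha omega Lambda ->
  exists (cl : 'I_S -> 'I_A) (x : 'I_S -> R),
    [/\ forall j a, (j \in Lambda a) = (cl j == a),
        forall j, node omega j = expi (- (2 * pi * x j)),
        forall j k, cl j = cl k -> `|x j - x k| <= M%:R^-1
      & forall j k, j != k -> alpha / M%:R <= `|x j - x k|].
Proof.
move=> model; have /boolp.choice[cl clP] : forall j, exists a, j \in Lambda a.
  move=> j; have : j \in [set: 'I_S]%SET by rewrite inE.
  by rewrite -(clumps_cover model) => /finset.bigcupP[a _ ja]; exists a.
have clE j a : (j \in Lambda a) = (cl j == a).
  apply/idP/eqP => [ja|<-]//; apply/eqP/negPn/negP => neq.
  have /setP/(_ j) := clumps_disjoint model neq.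
  by rewrite !inE ja clP.
have [c cP] := boolp.choice (clumps_arc model).
have /boolp.choice[n nP] j := cP (cl j) j (clP j).
exists cl, (fun j => omega j + (n j)%:~R); split => //.
- by move=> j; rewrite expi_shift.
- move=> j k jk; have := nP j; have := nP k; rewrite jk.
  move=> /andP[k1 k2] /andP[j1 j2]; rewrite ler_norml; apply/andP; split; lra.
- move=> j k jk; apply: le_trans (model_separation model jk) _.
  have := tnorm_le (omega j - omega k) (n k - n j); congr (_ <= `|_|).
  by rewrite intrD mulrNz; ring.
Qed.

(** Squaring the hypothesis on beta leaves only integer powers, the form that both cases use. *)
Lemma beta_sqr_ge (S l : nat) (alpha beta : R) : 0 < alpha -> 0 < beta ->
  20 * S%:R `^ (1 / 2) * l%:R `^ (5 / 2) / alpha `^ (1 / 2) <= beta ->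
  400 * S%:R * l%:R ^+ 5 <= alpha * beta ^+ 2.
Proof.
move=> a0 b0.
have sq (y : R) (n : nat) : 0 <= y -> (y `^ (n%:R / 2)) ^+ 2 = y ^+ n.
  by move=> y0; rewrite -powR_mulrn ?powR_ge0// -powRrM divfK ?pnatr_eq0// powR_mulrn.
have sq1 (y : R) : 0 <= y -> (y `^ (1 / 2)) ^+ 2 = y by move=> y0; rewrite (sq y 1).
rewrite ler_pdivrMr ?powR_gt0// => h.
have : (20 * S%:R `^ (1 / 2) * l%:R `^ (5 / 2)) ^+ 2 <= (beta * alpha `^ (1 / 2)) ^+ 2.
  by rewrite lerXn2r ?nnegrE// ?mulr_ge0 ?powR_ge0 ?(ltW b0)//.
rewrite !exprMn (sq _ 5)// !sq1 ?(ltW a0)//; set s := S%:R; set t := _ ^+ 5; lra.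
Qed.

(** Multiplied by l, the Lagrange part is at most M (l - 1). This leaves M for the kernel part 2 l^2
    P, whence P = floor(M / (2 l^2)). *)
Lemma interpolant_degree (M l : nat) : (0 < l)%N ->
  ((M %/ l) * (l - 1) + (M %/ (2 * l ^ 2)) * (2 * l) <= M)%N.
Proof.
move=> l0; rewrite -(leq_pmul2l l0).
have h1 := leq_trunc_div M l; have h2 := leq_trunc_div M (2 * l ^ 2).
case: l l0 h1 h2 => // n _ h1 h2; rewrite subn1 /=.
apply: (@leq_trans (M * n + M)); last by rewrite mulSn mulnC addnC.
rewrite mulnDr; apply: leq_add.
  by rewrite mulnA leq_mul2r mulnC h1 orbT.
by apply: leq_trans h2; rewrite expnS expn1; lia.
Qed.

Variables (S M : nat) (u : 'I_S -> R[i]) (L : {set 'I_S}).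
Hypothesis u1 : forall j, normc (u j) = 1.
Hypothesis L_gt0 : (0 < #|L|)%N.

Let l := #|L|.
Let Q := (M %/ l)%N.
Let P := (M %/ (2 * l ^ 2))%N.

Definition interpolant j := lagrange u L Q j * dirichlet (u j) P ^+ (2 * l).

Lemma size_interpolant j : j \in L -> (size (interpolant j) <= M.+1)%N.
Proof.
move=> jL; apply: leq_trans (size_polyMleq _ _) _.
have sL := size_lagrange u Q jL.
have sD : (size (dirichlet (u j) P ^+ (2 * l)) <= (P * (2 * l)).+1)%N.
  apply: leq_trans (size_poly_exp_leq _ _) _.
  have := size_poly P.+1 (fun i => P.+1%:R^-1 * ((u j)^*%C) ^+ i).
  by rewrite ltnS leq_mul2r -subn1 leq_subLR => ->; rewrite orbT.
have := interpolant_degree M L_gt0; rewrite -/l -/Q -/P -/l in sL sD *.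
by move: (size _) (size _) sL sD; lia.
Qed.

(** One kernel contributes its squared norm 1 / (P + 1) <= 2 l^2 / M, the Lagrange polynomial its
    squared sup norm. *)
Lemma interpolant_norm j : j \in L -> (0 < M)%N ->
  \sum_(m < M.+1) normc (interpolant j)`_m ^+ 2
  <= 2 * #|L|%:R ^+ 2 / M%:R
     * (\prod_(k in L | k != j) (half_chord u (M %/ #|L|) j k)^-1) ^+ 2.
Proof.
move=> jL M0; have := size_interpolant jL; rewrite /interpolant.
have -> : (2 * l = (2 * l).-1.+1)%N by rewrite prednK// muln_gt0.
move=> sz; have PM : (P < M.+1)%N by rewrite ltnS leq_div.
apply: le_trans (sum_coef_mul_dirichlet_le PM (u1 j) sz _) _.
  by move=> w; exact: (@normc_lagrange_le _ _ u L Q j w u1).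
rewrite mulrC ler_wpM2r ?sqr_ge0//.
rewrite -invf_div lef_pV2 ?posrE ?divr_gt0 ?mulr_gt0 ?exprn_gt0 ?ltr0n//.
rewrite ler_pdivrMr ?mulr_gt0 ?exprn_gt0 ?ltr0n// -natrX -!natrM ler_nat.
by apply: ltnW; rewrite ltn_ceil// muln_gt0 expn_gt0 L_gt0.
Qed.

End Interpolation.

Section Bounds.
Local Open Scope complex_scope.
Variable R : realType.

(** The kernel value D at w satisfies D^2 <= alpha / (225 S l), where 225 = 400 * 9 / 16. The l-th
    power of this absorbs the growth (2 l / alpha)^(l - 1) of the Lagrange factor, which explains
    the kernel exponent 2 l. *)
Lemma normc_interpolant_le (S M : nat) (u : 'I_S -> R[i]) (L : {set 'I_S})
    (alpha beta : R) (j : 'I_S) (w : R[i]) :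
  (forall k, normc (u k) = 1) -> normc w = 1 ->
  (0 < S)%N -> (0 < M)%N -> (0 < #|L|)%N -> 0 < alpha <= 1 -> 0 < beta ->
  400 * S%:R * #|L|%:R ^+ 5 <= alpha * beta ^+ 2 ->
  3 * (beta / M%:R) <= normc (w - u j) ->
  \prod_(k in L | k != j) (half_chord u (M %/ #|L|) j k)^-1
    <= (2 * #|L|%:R / alpha) ^+ (#|L| - 1) ->
  normc (interpolant M u L j).[w] <= (225 * S%:R)^-1.
Proof.
move=> u1 w1 S0 M0 L0 /andP[a0 a1] b0 hb hw hg.
rewrite /interpolant hornerM normcM horner_exp normcX.
have := normc_lagrange_le L (M %/ #|L|) j u1 w1; move=> /le_trans/(_ hg).
set G := normc _; set P := (M %/ (2 * #|L| ^ 2))%N.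
have := dirichlet_decay P (u1 j) w1; set D := normc (dirichlet _ _).[w] => hD hG.
have D0 : 0 <= D := normc_ge0 _.
have M0' : 0 < M%:R :> R by rewrite ltr0n.
have S1 : 1 <= S%:R :> R by rewrite ler1n.
have l1 : 1 <= #|L|%:R :> R by rewrite ler1n.
have hP : M%:R <= P.+1%:R * (2 * #|L|%:R ^+ 2) :> R.
  rewrite -natrX -!natrM ler_nat ltnW// ltn_ceil//.
  by rewrite muln_gt0 expn_gt0 L0.
move: L0 hb hg hG hP l1; set l := #|L| => L0 hb hg hG hP l1.
(* The decay estimate, in which P + 1 >= M / (2 l^2) cancels M. *)
have D1 : D * (3 * beta) <= 4 * l%:R ^+ 2.
  have h1 : D * (P.+1%:R * (3 * (beta / M%:R))) <= 2.
    by apply: le_trans hD; rewrite ler_wpM2l// ler_wpM2l.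
  have h2 : D * P.+1%:R * (3 * beta) <= 2 * M%:R.
    rewrite -ler_pdivrMr//; apply: le_trans h1.
    by rewrite le_eqVlt; apply/orP; left; apply/eqP; ring.
  have h3 : P.+1%:R * (D * (3 * beta)) <= P.+1%:R * (4 * l%:R ^+ 2).
    by apply: le_trans (_ : 2 * M%:R <= _); lra.
  by rewrite ler_pM2l ?ltr0n// in h3.
have D2 : D ^+ 2 <= alpha / (225 * S%:R * l%:R).
  have sq : (D * (3 * beta)) ^+ 2 <= (4 * l%:R ^+ 2) ^+ 2.
    by rewrite lerXn2r ?nnegrE ?mulr_ge0 ?sqr_ge0 ?(ltW b0).
  have e : D ^+ 2 * (400 * S%:R * l%:R ^+ 5) <= D ^+ 2 * (alpha * beta ^+ 2).
    by rewrite ler_wpM2l ?sqr_ge0.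
  have l4 : 0 < l%:R ^+ 4 :> R by rewrite exprn_gt0// (lt_le_trans ltr01).
  have k : l%:R ^+ 4 * (D ^+ 2 * (225 * S%:R * l%:R)) <= l%:R ^+ 4 * alpha.
    have : alpha * (D * (3 * beta)) ^+ 2 <= alpha * (4 * l%:R ^+ 2) ^+ 2.
      by rewrite ler_pM2l.
    rewrite !exprS !expr0 in e *; lra.
  rewrite ler_pdivlMr ?mulr_gt0 ?ltr0n//.
  by rewrite ler_pM2l in k.
have s0 : 0 < 225 * S%:R * l%:R :> R.
  by rewrite mulr_gt0 ?(lt_le_trans ltr01)//; lra.
have y0 : 0 <= alpha / (225 * S%:R * l%:R) by rewrite divr_ge0 ?ltW.
rewrite exprM; apply: (@le_trans _ _ ((2 * l%:R / alpha) ^+ (l - 1) *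
    (alpha / (225 * S%:R * l%:R)) ^+ l)).
  apply: ler_pM; [exact: normc_ge0|by rewrite exprn_ge0 ?sqr_ge0|exact: hG|].
  by apply: lerXn2r D2; rewrite nnegrE ?sqr_ge0.
have lE : l = (l - 1).+1 by rewrite subn1 prednK.
(* One factor is set apart; each of the l - 1 others is paired with 2 l / alpha and gives 2 / (225
   S) <= 1. *)
rewrite [X in _ * _ ^+ X <= _]lE exprSr mulrA -exprMn.
have -> : 2 * l%:R / alpha * (alpha / (225 * S%:R * l%:R)) = 2 / (225 * S%:R).
  have gen (p q r : R) : p != 0 -> q != 0 -> r != 0 ->
      2 * q / p * (p / (225 * r * q)) = 2 / (225 * r).
    by move=> p0 q0 r0; field; rewrite p0 q0 r0.
  by apply: gen; rewrite gt_eqF// (lt_le_trans ltr01).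
set r : R := 225 * S%:R; have r2 : 2 <= r by rewrite /r; lra.
have r0 : 0 < r by lra.
have x1 : 2 / r <= 1 by rewrite ler_pdivrMr ?mul1r.
have x0 : 0 <= 2 / r by rewrite divr_ge0 ?ltW.
(* The factor set apart is at most 1 / r, as alpha <= 1 <= l. *)
apply: (@le_trans _ _ (alpha / (r * l%:R))).
  by rewrite ler_piMl ?exprn_ile1.
rewrite ler_pdivrMr// mulrA mulVf ?mul1r ?gt_eqF//.
exact: le_trans l1.
Qed.

(** Reduces the theorem to the squared form M <= T Y^2, in which T = 0 would contradict m > 0. *)
Lemma sqrtM_powR_le (m T Y : R) : 0 < m -> 0 <= Y -> 0 <= T -> m <= T * Y ^+ 2 ->
  Num.sqrt m * T `^ (- (1 / 2)) <= Y.
Proof.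
move=> m0 Y0; rewrite le_eqVlt => /predU1P[<-|T0 h]; first by rewrite mul0r leNgt m0.
rewrite powRN div1r powR12_sqrt ?(ltW T0)// ler_pdivrMr ?sqrtr_gt0//.
rewrite -[X in X * _](ger0_norm Y0) -sqrtr_sqr -sqrtrM ?sqr_ge0//.
by rewrite ler_wsqrtr// mulrC.
Qed.

End Bounds.

(** * The bound for general clumps and for well separated singletons *)

Section Cases.
Local Open Scope complex_scope.
Variables (R : realType) (A M S : nat) (alpha beta : R).
Variables (omega : 'I_S -> R) (Lambda : 'I_A -> {set 'I_S}).
Hypotheses (A_gt0 : (0 < A)%N) (M_gt0 : (0 < M)%N) (S_gt0 : (0 < S)%N).
Hypotheses (S2_leM : (S ^ 2 <= M)%N) (alpha_gt0 : 0 < alpha) (beta_gt0 : 0 < beta).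
Hypothesis model : clumps_model_with_min_separation M beta alpha omega Lambda.
Hypothesis beta_large : (1 < A)%N -> forall a,
  400 * S%:R * #|Lambda a|%:R ^+ 5 <= alpha * beta ^+ 2.

Let T := \sum_(a < A) (Cconst R #|Lambda a| M * alpha ^- (#|Lambda a| - 1)) ^+ 2.

Let card_gt0 a : (0 < #|Lambda a|)%N.
Proof. by rewrite card_gt0 (clumps_nonempty model). Qed.

Let S_leM : (S <= M)%N.
Proof. by apply: leq_trans S2_leM; rewrite expnS expn1 leq_pmulr. Qed.

Let card_leM a : (#|Lambda a| <= M)%N.
Proof. by apply: leq_trans S_leM; rewrite -[leqRHS]card_ord max_card. Qed.

Lemma clumped_bound (v : 'cV[R[i]]_S) : ((1 < A)%N -> alpha <= 1) ->
  l2norm v = 1 -> M%:R <= T * l2norm (Phi omega M *m v) ^+ 2.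
Proof.
move=> alpha_le1 v1; have [cl [x [clE xE x_diam x_sep]]] := model_coordinates model.
pose u := node omega; pose L j := Lambda (cl j).
have u1 j : normc (u j) = 1 by exact: normc_node.
have inL j : j \in L j by rewrite clE.
have uE a : {in Lambda a, forall j, u j = expi (- (2 * pi * x j))}.
  by move=> j _; exact: xE.
have diam a : {in Lambda a &, forall j k, `|x j - x k| <= M%:R^-1}.
  by move=> j k; rewrite !clE => /eqP ja /eqP ka; apply: x_diam; rewrite ja ka.
have sep a : {in Lambda a &, forall j k, j != k -> alpha / M%:R <= `|x j - x k|}.
  by move=> j k _ _; exact: x_sep.
pose g (a : 'I_A) j : R := \prod_(k in Lambda a | k != j)
  (half_chord u (M %/ #|Lambda a|) j k)^-1.
pose H j := interpolant M u (L j) j.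
have sH j : (size (H j) <= M.+1)%N.
  exact: (@size_interpolant R S M u (L j) (card_gt0 (cl j)) j (inL j)).
have S0 : 0 < S%:R :> R by rewrite ltr0n.
have M0 : 0 < M%:R :> R by rewrite ltr0n.
have He j k : normc ((H j).[u k] - (j == k)%:R) <= (225 * S%:R)^-1.
  have e0 : 0 <= (225 * S%:R)^-1 :> R by rewrite invr_ge0; lra.
  (* Across clumps the kernel is tiny; within a clump the interpolation is exact. *)
  have [jk|jk] := eqVneq (cl j) (cl k); last first.
    have njk : j != k by apply: contra jk => /eqP ->.
    rewrite (negbTE njk) subr0.
    have A1 : (1 < A)%N.
      by rewrite -(card_ord A); apply/card_gt1P; exists (cl j), (cl k).
    apply: (@normc_interpolant_le _ _ _ _ _ alpha beta) => //.
    - exact: card_gt0.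
    - by rewrite alpha_gt0 alpha_le1.
    - exact: beta_large.
    - apply: le_trans (normc_expiB_ge_tnorm _ _); rewrite ler_pM2l//.
      rewrite eq_sym in jk.
      by apply: (clumps_separated model A1 jk); rewrite clE.
    - exact: (clump_prod_le alpha_gt0 (card_gt0 _) (card_leM _) (uE _) (diam _)
                (sep _) (inL _)).
  have kL : k \in L j by rewrite clE jk.
  rewrite /H /interpolant hornerM horner_exp.
  have [<-|njk] := eqVneq j k.
    rewrite dirichlet_center// expr1n mulr1 lagrange_self ?subrr ?normc0//.
    move=> i iL ij; rewrite eq_sym in ij.
    exact: (clump_nodes_neq alpha_gt0 (card_gt0 _) (card_leM _) (uE _) (diam _)
              (sep _)).
  by rewrite lagrange_other 1?eq_sym// mul0r subr0 normc0.
have dual := duality v1 sH He.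
set Y := l2norm _ in dual *.
set U := \sum_j \sum_(m < M.+1) _ in dual.
(* Clump by clump, 2 l^2 = (361/400) (800/361) l^2 links [interpolant_norm] to [clump_sum_le]. The
   factor 361/400 = (19/20)^2 pays for the interpolation error below. *)
have UT : U <= 361 / 400 * T / M%:R.
  apply: (@le_trans _ _ (\sum_j 2 * #|L j|%:R ^+ 2 / M%:R * g (cl j) j ^+ 2)).
    apply: ler_sum => j _.
    exact: (@interpolant_norm R S M u (L j) u1 (card_gt0 (cl j)) j (inL j) M_gt0).
  rewrite (partition_big cl predT)//= /T mulr_sumr mulr_suml.
  apply: ler_sum => a _.
  have := clump_sum_le alpha_gt0 (card_gt0 a) (card_leM a) (uE a) (diam a) (sep a).
  set C := (_ * alpha ^- _) ^+ 2; rewrite -/(g a _) => h.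
  have -> : \sum_(j | cl j == a) 2 * #|L j|%:R ^+ 2 / M%:R * g (cl j) j ^+ 2
     = 2 * #|Lambda a|%:R ^+ 2 / M%:R * \sum_(j in Lambda a) g a j ^+ 2.
    rewrite mulr_sumr; apply: eq_big => [j|j /eqP cla]; first by rewrite clE.
    by rewrite /L cla.
  rewrite mulrAC ler_pM2r ?invr_gt0//.
  have {}h : 800 / 361 * #|Lambda a|%:R ^+ 2 * \sum_(j in Lambda a) g a j ^+ 2 <= C.
    exact: h.
  lra.
(* The total error S e is 1/225, less than 1/20. *)
have d1 : 19 / 20 <= Num.sqrt U * Y.
  apply: le_trans dual; rewrite invfM mulrCA mulfV ?gt_eqF// mulr1; lra.
have Y0 : 0 <= Y := l2norm_ge0 _.
have U0 : 0 <= U.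
  by apply: sumr_ge0 => j _; apply: sumr_ge0 => m _; exact: sqr_ge0.
have d2 : (19 / 20) ^+ 2 <= U * Y ^+ 2.
  rewrite -(sqr_sqrtr U0) -exprMn lerXn2r ?nnegrE ?mulr_ge0 ?sqrtr_ge0//; lra.
have Z1 : 1 <= T / M%:R * Y ^+ 2.
  have e : (19 / 20) ^+ 2 <= 361 / 400 * (T / M%:R * Y ^+ 2).
    apply: le_trans d2 _; rewrite [leRHS]mulrA [X in _ <= X * _]mulrA.
    by apply: ler_wpM2r UT; exact: sqr_ge0.
  by rewrite expr2 in e; lra.
have -> : T * Y ^+ 2 = T / M%:R * Y ^+ 2 * M%:R by field; rewrite gt_eqF.
by rewrite ler_peMl// ltW.
Qed.

Lemma singletons_bound (v : 'cV[R[i]]_S) : (1 < A)%N -> 1 < alpha ->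
  l2norm v = 1 -> M%:R <= T * l2norm (Phi omega M *m v) ^+ 2.
Proof.
move=> A1 alpha_gt1 v1.
have [cl [x [clE _ _ _]]] := model_coordinates model.
(* All l - 1 are below 1 / alpha < 1, hence 0. *)
have card1 a : #|Lambda a| = 1%N.
  have := clumps_card model; have : alpha^-1 < 1 by rewrite invf_lt1.
  move=> h1 h2; have := lt_trans h2 h1; rewrite -[1 in X in X -> _]/(1%:R) ltr_nat => h.
  apply/eqP; rewrite eqn_leq card_gt0 andbT -subn_eq0 -leqn0 -ltnS.
  by apply: leq_ltn_trans h; exact: (@leq_bigmax _ (fun a => (#|Lambda a| - 1)%N) a).
pose a0 := Ordinal A_gt0.
have S0 : 0 < S%:R :> R by rewrite ltr0n.
have M0 : 0 < M%:R :> R by rewrite ltr0n.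
have S2 : 2 <= S%:R :> R.
  have /card_gt1P[a [b [_ _ ab]]] : (1 < #|'I_A|)%N by rewrite card_ord.
  have /finset.set0Pn[j ja] := clumps_nonempty model a.
  have /finset.set0Pn[k kb] := clumps_nonempty model b.
  rewrite (ler_nat _ 2) -(card_ord S); apply/card_gt1P; exists j, k; split => //.
  apply: contra ab => /eqP e; move: ja kb; rewrite !clE e => /eqP <- /eqP <-.
  exact: eqxx.
have ab2 : 400 * S%:R <= alpha * beta ^+ 2.
  by have := beta_large A1 a0; rewrite card1 expr1n mulr1.
(* Distinct nodes lie in distinct clumps, so both separations apply, and d^3 >= alpha beta^2 >= 400
   S. *)
pose d := Num.max alpha beta.
have da : alpha <= d by rewrite le_max lexx.
have db : beta <= d by rewrite le_max lexx orbT.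
have d3 : 400 * S%:R <= d ^+ 3.
  apply: le_trans ab2 _; rewrite [d ^+ 3]exprS ler_pM ?(ltW alpha_gt0) ?sqr_ge0//.
  by rewrite lerXn2r ?nnegrE// ?(ltW beta_gt0) ?(le_trans (ltW beta_gt0) db).
(* Otherwise d^3 <= 729 < 800 <= 400 S. *)
have d9 : 9 <= d.
  rewrite leNgt; apply/negP => d9.
  have : d ^+ 3 <= 9 ^+ 3 by rewrite lerXn2r ?nnegrE ?ltW// (lt_le_trans alpha_gt0).
  rewrite !exprS expr0; lra.
(* The fourth power of the kernel then has degree at most 4 P <= M. *)
pose P := (M %/ 4)%N.
have PM : M%:R <= P.+1%:R * 4 :> R.
  by rewrite -natrM ler_nat ltnW// ltn_ceil.
have sep j k : j != k -> 3 * (d / M%:R) <= normc (node omega k - node omega j).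
  move=> jk; rewrite eq_sym in jk; apply: le_trans (normc_expiB_ge_tnorm _ _).
  rewrite ler_pM2l//; have h1 := model_separation model jk.
  rewrite /d; case: (leP alpha beta) => _ //.
  have clkj : cl k != cl j.
    apply: contra jk => /eqP e.
    have /eqP/cards1P[i iE] := card1 (cl j).
    have : k \in Lambda (cl j) by rewrite clE e.
    have : j \in Lambda (cl j) by rewrite clE.
    by rewrite iE !inE => /eqP -> /eqP ->.
  by apply: (clumps_separated model A1 clkj); rewrite clE.
pose W : {poly R[i]} := dirichlet 1 P ^+ 4.
have sW : (size W <= M.+1)%N.
  apply: leq_trans (size_poly_exp_leq _ _) _; rewrite ltnS.
  apply: leq_trans (leq_trunc_div M 4); rewrite leq_mul2r -subn1 leq_subLR add1n.
  by rewrite size_poly orbT.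
(* Decay with P + 1 >= M / 4 and chords of at least 3 d / M bounds the kernel by 8 / (3 d). *)
have We j k : normc (W.[node omega k * (node omega j)^*%C] - (j == k)%:R)
              <= (8 / (3 * d)) ^+ 4.
  have d0 : 0 < d by lra.
  have e0 : 0 <= 8 / (3 * d) by rewrite divr_ge0// mulr_ge0// ltW.
  have [<-|jk] := eqVneq j k.
    rewrite expi_conjM /W horner_exp dirichlet_center ?normc1//.
    by rewrite expr1n subrr normc0 exprn_ge0.
  rewrite subr0 /W horner_exp normcX.
  set w := node omega k * _.
  have w1 : normc w = 1 by rewrite normcM normc_conj !normc_node mulr1.
  have := dirichlet_decay P (normc1 R) w1.
  have -> : normc (w - 1) = normc (node omega k - node omega j).
    rewrite -(expi_conjM (- (2 * pi * omega j))) -mulrBl normcM.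
    by rewrite normc_conj normc_expi mulr1.
  set D := normc _ => hD; have D0 : 0 <= D := normc_ge0 _.
  rewrite lerXn2r ?nnegrE//; rewrite ler_pdivlMr ?mulr_gt0//.
  have h1 : D * (P.+1%:R * (3 * (d / M%:R))) <= 2.
    by apply: le_trans hD; rewrite ler_wpM2l// ler_wpM2l// sep.
  have h2 : D * P.+1%:R * (3 * d) <= 2 * M%:R.
    rewrite -ler_pdivrMr//; apply: le_trans h1.
    by rewrite le_eqVlt; apply/orP; left; apply/eqP; ring.
  have h3 : P.+1%:R * (D * (3 * d)) <= P.+1%:R * 8 by lra.
  by rewrite ler_pM2l ?ltr0n// in h3.
have := weighted_gram v1 sW (coef_dirichlet_exp4 R P) We.
set Y := l2norm _ ^+ 2 => gram.
have Y0 : 0 <= Y by exact: sqr_ge0.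
(* As d^4 >= 400 S d >= 3600 S, the error is at most 4096 / (81 * 3600) < 0.05. *)
have err : S%:R * (8 / (3 * d)) ^+ 4 <= 5 / 100.
  have d0 : 0 < d by lra.
  rewrite expr_div_n mulrA ler_pdivrMr ?exprn_gt0 ?mulr_gt0//.
  have : 400 * S%:R * d <= d ^+ 4 by rewrite [leRHS]exprSr ler_pM2r.
  have : S%:R * 9 <= S%:R * d by rewrite ler_pM2l.
  rewrite exprMn; have -> : 8 ^+ 4 = 4096 :> R by ring.
  have -> : 3 ^+ 4 = 81 :> R by ring.
  by set q := d ^+ 4; lra.
(* For l = 1 the sum in [node_sum] is a single empty product, so each clump contributes (20 sqrt 2 /
   19)^2. *)
have TA : T = A%:R * (800 / 361).
  rewrite /T (eq_bigr (fun=> 800 / 361)) => [|a _].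
    by rewrite sumr_const card_ord [RHS]mulr_natl.
  rewrite card1 subnn expr0 invr1 mulr1 Cconst_sqr// subnn expr0 mulr1.
  rewrite /node_sum big_nat1 big_nat_cond big_pred0 ?mulr1 ?expr1n ?mulr1//.
  by move=> k; case: k => [|[|k]].
have A2 : 2 <= A%:R :> R by rewrite (ler_nat _ 2).
have PY : P.+1%:R * (95 / 100) <= Y.
  rewrite -ler_pdivlMl ?ltr0n//; apply: le_trans gram.
  by move: err; set q := S%:R * _; lra.
have AY : 2 * Y <= A%:R * Y by rewrite ler_wpM2r.
(* T Y >= 2 (800/361) (95/100) (M / 4), which exceeds M. *)
rewrite TA; lra.
Qed.

End Cases.

Theorem theorem2p7 (R : realType) (A M S : nat) (alpha beta : R)
    (omega : 'I_S -> R) (Lambda : 'I_A -> {set 'I_S}) :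
  (0 < A)%N -> (0 < M)%N -> (0 < S)%N -> (S ^ 2 <= M)%N ->
  0 < alpha -> 0 < beta ->
  clumps_model_with_min_separation M beta alpha omega Lambda ->
  ((1 < A)%N -> forall a : 'I_A,
     20 * S%:R `^ (1 / 2) * #|Lambda a|%:R `^ (5 / 2) / alpha `^ (1 / 2)
       <= beta) ->
  Num.sqrt M%:R *
    (\sum_(a < A) (Cconst R #|Lambda a| M * alpha ^- (#|Lambda a| - 1)) ^+ 2)
      `^ (- (1 / 2))
  <= sigma_min (Phi omega M).
Proof.
move=> A0 M0 S0 S2M a0 b0 model hbeta.
have beta_large : (1 < A)%N -> forall a,
    400 * S%:R * #|Lambda a|%:R ^+ 5 <= alpha * beta ^+ 2.
  by move=> A1 a; apply: beta_sqr_ge => //; exact: hbeta.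
apply: sigma_min_ge => // v v1; apply: sqrtM_powR_le.
- by rewrite ltr0n.
- exact: l2norm_ge0.
- by apply: sumr_ge0 => a _; exact: sqr_ge0.
case: (leP alpha 1) => [a1|a1].
  exact: (clumped_bound M0 S0 S2M a0 b0 model beta_large _ v1).
have [A1|A1] := ltnP 1 A.
  exact: (singletons_bound A0 M0 S0 a0 b0 model beta_large A1 a1 v1).
(* With a single clump there are no cross terms to estimate, so alpha > 1 is harmless here. *)
apply: (clumped_bound M0 S0 S2M a0 b0 model beta_large _ v1) => A2.
by rewrite ltnNge A1 in A2.
Qed.
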